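(* Let $n\ge 300^3$ be an integer. Then $$\mathrm{ex}(n,K_3,P_3^3)=\left\lfloor\frac{(n-1)^2}{4}\right\rfloor,$$ and the unique extremal graph is $K_1+K_{\lfloor (n-1)/2\rfloor,\lceil (n-1)/2\rceil}$, i.e. it is, up to isomorphism, the unique $n$-vertex $P_3^3$-free graph containing exactly $\mathrm{ex}(n,K_3,P_3^3)$ triangles.
   Context: All graphs are finite and simple. For graphs $T$ and $H$, a graph is $H$-free if it contains no (not necessarily induced) subgraph isomorphic to $H$, and the generalized Turán number $\mathrm{ex}(n,T,H)$ is the maximum number of copies of $T$ (subgraphs isomorphic to $T$) in an $n$-vertex $H$-free graph; thus $\mathrm{ex}(n,K_3,H)$ is the maximum number of triangles in an $n$-vertex $H$-free graph. For a graph $H$ and an integer $p>2$, the edge blow-up $H^p$ is the graph obtained from $H$ by replacing each edge of $H$ by a copy of $K_p$ containing that edge, where the $p-2$ new vertices of each clique are distinct from the vertices of $H$ and from the new vertices of all other cliques. $P_k$ denotes the path with $k$ edges, so $P_3^3$ is the 7-vertex graph consisting of a path $v_0v_1v_2v_3$ together with three further distinct vertices $w_1,w_2,w_3$, where $w_i$ is adjacent to $v_{i-1}$ and $v_i$. $K_{s,t}$ is the complete bipartite graph with parts of sizes $s$ and $t$. $G+H$ denotes the join of $G$ and $H$: the graph obtained from the disjoint union of $G$ and $H$ by adding all edges with one endvertex in $V(G)$ and the other in $V(H)$. *)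

(* Defs.v *)
From HB Require Import structures.
From mathcomp Require Import all_boot.

Set Implicit Arguments.
Unset Strict Implicit.
Unset Printing Implicit Defensive.

Record graph (V : finType) := Graph {
  edges : {set {set V}};
  edgesP : edges \subset [set e : {set V} | #|e| == 2]
}.

HB.instance Definition _ (V : finType) := [isSub for @edges V].
HB.instance Definition _ (V : finType) := [Finite of graph V by <:].

Definition adj (V : finType) (G : graph V) : rel V :=
  [rel x y | [set x; y] \in edges G].

Lemma pairsP (V : finType) (P : pred {set V}) :
  [set e : {set V} | (#|e| == 2) && P e] \subset [set e : {set V} | #|e| == 2].
Proof. by apply/subsetP => e; rewrite !inE => /andP[]. Qed.

Definition pairs_graph (V : finType) (P : pred {set V}) : graph V :=
  Graph (pairsP P).

(* r need not be symmetric or irreflexive: x and y are adjacent iff they are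
   distinct and r x y or r y x holds (see adj_graph_of). *)
Definition graph_of (V : finType) (r : rel V) : graph V :=
  pairs_graph (fun e => [exists x, exists y, (e == [set x; y]) && r x y]).

Lemma adj_graph_of (V : finType) (r : rel V) (x y : V) :
  adj (graph_of r) x y = (x != y) && (r x y || r y x).
Proof.
have [->|xy] := eqVneq x y; rewrite /adj /= inE cards2 ?eqxx // xy /=.
apply/existsP/orP.
  move=> [a /existsP[b /andP[/eqP/setP E rab]]].
  have := E x; have := E y; rewrite !inE !eqxx /= orbT => /esym Ey /esym Ex.
  case/orP: Ex => /eqP ex; case/orP: Ey => /eqP ey; subst; auto.
    by rewrite eqxx in xy.
  by rewrite eqxx in xy.
case=> rxy; [exists x|exists y]; apply/existsP; [exists y|exists x].
  by rewrite eqxx.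
by rewrite setUC eqxx.
Qed.

Definition isomorphic (V W : finType) (G : graph V) (H : graph W) : Prop :=
  exists2 f : V -> W, bijective f & forall x y, adj G x y = adj H (f x) (f y).

(* A subgraph is the pair of its vertex set and its edge set. *)
Definition is_subgraph (V : finType) (G : graph V)
    (S : {set V} * {set {set V}}) : bool :=
  (S.2 \subset edges G) && [forall e in S.2, e \subset S.1].

Definition subgraph_iso (V W : finType) (S : {set V} * {set {set V}})
    (T : graph W) : bool :=
  [exists f : {ffun W -> V},
    [&& injectiveb f, f @: [set: W] == S.1
      & [forall x, forall y, adj T x y == ([set f x; f y] \in S.2)]]].

Definition copies (W V : finType) (T : graph W) (G : graph V) :
    {set {set V} * {set {set V}}} :=
  [set S | is_subgraph G S && subgraph_iso S T].

Definition Hfree (W V : finType) (H : graph W) (G : graph V) : bool :=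
  copies H G == set0.

(* Up to isomorphism, 'I_n carries every n-vertex graph.  The maximum is 0 by
   convention if no n-vertex graph is H-free (only possible for edgeless H). *)
Definition ex_turan (n : nat) (W U : finType) (T : graph W) (H : graph U) :
    nat :=
  \max_(G : graph 'I_n | Hfree H G) #|copies T G|.

Definition complete (n : nat) : graph 'I_n := graph_of (fun _ _ => true).

(* k edges, k + 1 vertices *)
Definition path_graph (k : nat) : graph 'I_k.+1 :=
  graph_of (fun i j : 'I_k.+1 => j == i.+1 :> nat).

Definition complete_bipartite (s t : nat) : graph ('I_s + 'I_t)%type :=
  graph_of (fun x y =>
    match x, y with inl _, inr _ => true | _, _ => false end).

Definition join (V W : finType) (G : graph V) (H : graph W) :
    graph (V + W)%type :=
  graph_of (fun x y =>
    match x, y with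
    | inl a, inl b => adj G a b
    | inr a, inr b => adj H a b
    | inl _, inr _ => true
    | inr _, inl _ => false
    end).

Definition edge_type (V : finType) (H : graph V) : finType :=
  {e : {set V} | e \in edges H}.

Definition blowup_type (V : finType) (H : graph V) (p : nat) : finType :=
  (V + edge_type H * 'I_(p - 2))%type.

(* The vertex set of the K_p replacing e: the two ends of e and the p - 2 new
   vertices (e, i). *)
Definition blowup_clique (V : finType) (H : graph V) (p : nat)
    (e : edge_type H) : {set blowup_type H p} :=
  [set inl x | x in val e] :|: [set inr (e, i) | i : 'I_(p - 2)].

Definition edge_blowup (V : finType) (H : graph V) (p : nat) :
    graph (blowup_type H p) :=
  pairs_graph (fun f => [exists e : edge_type H, f \subset blowup_clique p e]).

(* Main.v *)
Require Import Defs.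
From mathcomp Require Import all_boot.
From mathcomp Require Import zify.

(** The graph to be excluded is a chain of three triangles T1, T2, T3 in which
    T1 meets T2 in one vertex, T2 meets T3 in another, and T1 is disjoint from
    T3.  A graph all of whose triangles share a vertex x, called an apex here,
    has no two disjoint triangles and hence no such chain.  Its triangles
    correspond to the edges of the link of x, which is triangle-free because a
    triangle in it would avoid x; so Mantel's theorem ([mantel]) bounds their
    number by the floor of (n - 1)^2 / 4, and its equality case determines the
    graph.  What has to be shown is that a chain-free graph with at least that
    many triangles has an apex.

    If some vertex lies in fewer than D = floor((k - 1) / 2) triangles, k being
    the current number of vertices, delete it: the extremal function drops by
    exactly D, so the surplus of triangles over it grows ([peel]).  A graph on
    k vertices has at most k^3 ordered triangles, so this stops while
    k >= 300.  In the graph where it stops every vertex lies in at least D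
    triangles, and an apex is found as follows ([exists_apex]).

    Call x dispersed if no four vertices meet all edges of its link.  Through a
    dispersed x there is a triangle avoiding any four given vertices, which can
    serve as T1; so if x a b is a triangle, every triangle at a contains x or
    b ([dispersed_link]).  Either all triangles at a contain x, or a b is an
    isolated edge of the link and almost all triangles at a pass through a b,
    with third vertices outside the link of x.  There is no room for the latter
    beside the link itself ([link_captive]).  So the whole link of x is captive:
    all triangles at its vertices contain x.  The link then has at least 2 D
    vertices, too many to leave space for a triangle avoiding x
    ([dispersed_apex]).

    If no vertex is dispersed, then four vertices cover each link, so each x
    has a neighbour h x such that the edge from x to h x lies in many
    triangles, and h takes each value at most four times.  A triangle at x
    avoiding h x could be extended by a triangle x, h x, z and a triangle z,
    h z, s to a chain, so all triangles at x contain h x.  But then a triangle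
    x, h x, z with h z different from x and h x contradicts the same fact
    at z ([exists_dispersed]).

    Once the apex is there, Mantel's bound in the smaller graph is compatible
    with the surplus only if nothing was deleted ([extremal_structure]). *)

(** * Triangles and chains of triangles *)

Set Implicit Arguments.
Unset Strict Implicit.
Unset Printing Implicit Defensive.

Section Triangles.

Variables (V : finType) (e : rel V).

Definition tri x y z := [&& e x y, e x z & e y z].

Definition codeg x y := #|[set z | tri x y z]|.

(** Each triangle at [x] counts twice here and each triangle six times in
    [tcount]: counting ordered triples makes all double counts exchanges of
    sums. *)
Definition tdeg x := \sum_y codeg x y.

Definition tcount := \sum_x tdeg x.

(** The chain has middle triangle [p q c], glued to the others at [p] and
    [q]. *)
Definition loose_free := forall p q c a b d f,
  tri p a b -> tri p q c -> tri q d f -> ~~ uniq [:: p; q; c; a; b; d; f].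

(** Four is the number of vertices besides [p] that a triangle [p a b] has to
    avoid in order to start the chain p a b, p q c, q d f. *)
Definition dispersed x := [forall F : {set V}, (#|F| <= 4) ==>
  [exists a, exists b, [&& tri x a b, a \notin F & b \notin F]]].

Definition apex x := forall a b c, tri a b c -> x \in [:: a; b; c].

Lemma dispersedP x (F : {set V}) : dispersed x -> #|F| <= 4 ->
  exists a b, [/\ tri x a b, a \notin F & b \notin F].
Proof.
move=> /forallP/(_ F)/implyP H /H /existsP[a /existsP[b /and3P[xab aF bF]]].
by exists a, b.
Qed.

Lemma dispersedI x : (forall F : {set V}, #|F| <= 4 ->
  exists a b, [/\ tri x a b, a \notin F & b \notin F]) -> dispersed x.
Proof.
move=> H; apply/forallP => F; apply/implyP => /H[a [b abP]].
by apply/existsP; exists a; apply/existsP; exists b; apply/and3P.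
Qed.

Lemma not_dispersed x : ~~ dispersed x -> exists2 F : {set V}, #|F| <= 4 &
  forall a b, tri x a b -> (a \in F) || (b \in F).
Proof.
case/forallPn => F; rewrite negb_imply => /andP[F4 none]; exists F => // a b xab.
apply: contraNT none; rewrite negb_or => /andP[aF bF].
by apply/existsP; exists a; apply/existsP; exists b; apply/and3P.
Qed.

Lemma codeg_sum x y : codeg x y = \sum_z tri x y z.
Proof.
by rewrite /codeg -sum1_card big_mkcond; apply: eq_bigr => z _; rewrite inE; case: tri.
Qed.

Hypothesis esym : symmetric e.
Hypothesis eirr : irreflexive e.

Lemma triC12 x y z : tri x y z = tri y x z.
Proof. by rewrite /tri (esym y x) andbCA [e y z && _]andbC andbCA. Qed.

Lemma triC23 x y z : tri x y z = tri x z y.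
Proof. by rewrite /tri (esym z y) andbCA. Qed.

Lemma tri_uniq x y z : tri x y z -> uniq [:: x; y; z].
Proof.
case/and3P => exy exz eyz; rewrite /= !inE negb_or andbT -andbA; apply/and3P.
by split; apply/eqP => E; move: exy exz eyz; rewrite E ?eirr.
Qed.

Lemma codegC x y : codeg x y = codeg y x.
Proof. by apply: eq_card => z; rewrite !inE triC12. Qed.

Lemma codeg_gt0 x y z : tri x y z -> 0 < codeg x y.
Proof. by move=> xyz; apply/card_gt0P; exists z; rewrite inE. Qed.

(** Both orderings of a link edge meet the cover, which gives the factor 2. *)
Lemma tdeg_cover x (F : {set V}) :
  (forall a b, tri x a b -> (a \in F) || (b \in F)) ->
  tdeg x <= 2 * \sum_(a in F) codeg x a.
Proof.
move=> cov.
have E : \sum_(a in F) codeg x a = \sum_a \sum_b ((a \in F) && tri x a b).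
  rewrite big_mkcond; apply: eq_bigr => a _; case: ifP => aF.
    by rewrite codeg_sum.
  by rewrite big1.
have -> : 2 * \sum_(a in F) codeg x a = \sum_a \sum_b
   (((a \in F) && tri x a b) + ((b \in F) && tri x a b)).
  rewrite mul2n -addnn {1}E E [X in _ + X = _]exchange_big -big_split.
  apply: eq_bigr => a _; rewrite -big_split; apply: eq_bigr => b _.
  by rewrite [tri x b a]triC23.
apply: leq_sum => a _; rewrite codeg_sum; apply: leq_sum => b _.
by case T: (tri x a b) => //; move: (cov _ _ T); case: (a \in F); case: (b \in F).
Qed.

Lemma pick_outside (A F : {set V}) : #|F| < #|A| -> exists2 z, z \in A & z \notin F.
Proof.
move=> lt; have : ~~ (A \subset F) by apply/negP => /subset_leq_card; lia.
by case/subsetPn => z zA zF; exists z.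
Qed.

Lemma pick_codeg x y (F : {set V}) :
  #|F| < codeg x y -> exists2 z, tri x y z & z \notin F.
Proof. by case/pick_outside => z; rewrite inE => xyz zF; exists z. Qed.

Lemma card_seq_le (s : seq V) : #|[set z in s]| <= size s.
Proof. by rewrite cardsE card_size. Qed.

Hypothesis free : loose_free.

(** Otherwise a triangle at [x] avoiding [a], [b], [c], [d] extends the two
    triangles to a chain with middle triangle [x a b]. *)
Lemma dispersed_link x a b c d : dispersed x ->
  tri x a b -> tri a c d -> x \notin [:: c; d] -> b \in [:: c; d].
Proof.
move=> dx xab acd xcd; apply/negPn/negP => bcd.
have [p [q [xpq]]] := dispersedP dx (card_seq_le [:: a; b; c; d]).
rewrite !inE => pF qF; have := free xpq xab acd; rewrite /= !inE.
move: (tri_uniq xpq) (tri_uniq xab) (tri_uniq acd).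
rewrite /= !inE in xcd bcd *.
rewrite !(eq_sym p) !(eq_sym q).
move: xcd bcd pF qF; rewrite !(eq_sym p) !(eq_sym q).
by do ! case: eqP => //= _.
Qed.

(** * An apex from a minimum degree condition *)

(** Deleting vertices is modelled by shrinking the support [S] of the adjacency
    relation, so that all graphs live on the same type. *)
Variable S : {set V}.
Hypothesis esupp : forall x y, e x y -> x \in S.

Let D := (#|S| - 1)./2.
Hypothesis mindeg : forall x, x \in S -> 2 * D <= tdeg x.

Lemma tri_supp x y z : tri x y z -> [/\ x \in S, y \in S & z \in S].
Proof.
case/and3P=> exy exz eyz; split; [exact: esupp exy | exact: esupp eyz |].
by rewrite esym in eyz; apply: esupp eyz.
Qed.

Definition captive x a := [forall c, forall d, tri a c d ==> (x \in [:: c; d])].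

Lemma captiveP x a :
  reflect (forall c d, tri a c d -> x \in [:: c; d]) (captive x a).
Proof.
apply: (iffP forallP) => [H c d acd | H c].
  by have /forallP/(_ d)/implyP := H c; apply.
by apply/forallP => d; apply/implyP/H.
Qed.

Lemma not_captive x a : ~~ captive x a ->
  exists c d, tri a c d /\ x \notin [:: c; d].
Proof.
case/forallPn => c /forallPn[d]; rewrite negb_imply => /andP[acd xcd].
by exists c, d.
Qed.

Lemma captive_codeg x a : a \in S -> captive x a -> D <= codeg x a.
Proof.
move=> aS /captiveP ga; have := mindeg aS.
have /tdeg_cover : forall c d, tri a c d -> (c \in [set x]) || (d \in [set x]).
  by move=> c d /ga; rewrite !inE ![x == _]eq_sym.
rewrite big_set1 codegC; lia.
Qed.

Definition link x := [set a | 0 < codeg x a].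

Lemma linkP x a : reflect (exists b, tri x a b) (a \in link x).
Proof.
rewrite inE; apply: (iffP idP) => [/card_gt0P[b]|[b /codeg_gt0//]].
by rewrite inE => xab; exists b.
Qed.

Lemma tri_neq x y z : tri x y z -> [/\ x != y, x != z & y != z].
Proof. by move/tri_uniq; rewrite /= !inE negb_or andbT => /andP[/andP[]]. Qed.

Lemma codeg_le1 x a b c : codeg x a <= 1 -> tri x a b -> tri x a c -> b = c.
Proof. by move=> /card_le1_eqP H xab xac; apply: H; rewrite inE. Qed.

(** All triangles at [a] turn out to contain [b], so at least [D] vertices
    complete the edge [a b].  None of them lies in the link of [x]: if [x z y]
    is a triangle, then [dispersed_link] applied to [z a b] forces [y] to be
    [a] or [b]; it is not [a], whose only link neighbour is [b], and if it is
    [b], the triangle of [a], [b] and a further common neighbour contradicts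
    [dispersed_link]. *)
Lemma dispersed_pair x a b : 5 <= D -> dispersed x -> tri x a b -> ~~ captive x a ->
  [/\ codeg x a <= 1, D <= codeg a b & #|link x| + D <= #|S|].
Proof.
move=> D5 dx xab /not_captive[c [d [acd xcd]]].
have [xS aS bS] := tri_supp xab.
have [xNa xNb aNb] := tri_neq xab.
have meet_b p q : tri a p q -> x \notin [:: p; q] -> b \in [:: p; q].
  by move=> apq xpq; apply: dispersed_link xab apq xpq.
have xa2 : codeg x a <= 2.
  apply: leq_trans (card_seq_le [:: c; d]); apply/subset_leq_card/subsetP => y.
  by rewrite !inE => xay; have := dispersed_link dx xay acd xcd; rewrite !inE.
(* Enough common neighbours of a and b to avoid any two given vertices. *)
have ab3 : 2 < codeg a b.
  have : tdeg a <= 2 * \sum_(u in [set x; b]) codeg a u.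
    apply: tdeg_cover => p q apq; rewrite !inE.
    have [|/(meet_b _ _ apq)] := boolP (x \in [:: p; q]); rewrite !inE.
      by rewrite ![x == _]eq_sym => /orP[]->; rewrite ?orbT.
    by rewrite ![b == _]eq_sym => /orP[]->; rewrite ?orbT.
  rewrite big_setU1 ?inE //= big_set1 [codeg a x]codegC => le.
  have := mindeg aS; lia.
have pick_ab (u v : V) : exists z, [/\ tri a b z, z != u & z != v].
  have [|z abz] := @pick_codeg a b [set u; v]; first by rewrite cards2; case: eqP; lia.
  by rewrite !inE negb_or => /andP[]; exists z.
have only_b y : tri x a y -> y = b.
  move=> xay; apply/eqP/negPn/negP => yNb.
  have [z [abz zx zy]] := pick_ab x y.
  have := dispersed_link dx xay abz.
  by rewrite !inE !negb_or xNb (eq_sym x) zx (negPf yNb) (eq_sym y) (negPf zy) => /(_ isT).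
have xa1 : codeg x a <= 1.
  by apply/card_le1_eqP => y z; rewrite !inE => /only_b-> /only_b->.
have abD : D <= codeg a b.
  have := mindeg aS; have : tdeg a <= 2 * \sum_(u in [set b]) codeg a u.
    apply: tdeg_cover => p q apq; rewrite !inE.
    have [|/(meet_b _ _ apq)] := boolP (x \in [:: p; q]); rewrite !inE.
      case/orP => /eqP E; move: apq; rewrite -E.
        by rewrite triC12 => /only_b->; rewrite eqxx orbT.
      by rewrite triC23 triC12 => /only_b->; rewrite eqxx.
    by rewrite ![b == _]eq_sym.
  rewrite big_set1; lia.
split=> //; apply: leq_trans (leq_add (leqnn _) abD) _.
rewrite -cardsUI [_ :&: _](_ : _ = set0).
  rewrite cards0 addn0; apply/subset_leq_card/subsetP => z.
  rewrite in_setU => /orP[/linkP[y /tri_supp[]]//|].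
  by rewrite inE => /tri_supp[].
apply/setP => z; rewrite in_setI in_set0; apply/negP => /andP[/linkP[y xzy]].
rewrite inE => abz; have [_ aNz bNz] := tri_neq abz; have [xNz _ _] := tri_neq xzy.
have zab : tri z a b by rewrite triC12 triC23.
have := dispersed_link dx xzy zab.
rewrite !inE !negb_or xNa xNb => /(_ isT)/orP[]/eqP yE.
  by move: xzy bNz; rewrite yE triC23 => /only_b->; rewrite eqxx.
have [t [abt tx tz]] := pick_ab x z.
have xbz : tri x b z by rewrite triC23 -yE.
have bat : tri b a t by rewrite triC12.
have := dispersed_link dx xbz bat.
rewrite !inE !negb_or xNa (eq_sym x) tx => /(_ isT).
by rewrite (eq_sym z a) (negPf aNz) (eq_sym z) (negPf tz).
Qed.

(** A non-captive link vertex bounds the link by [#|S| - D], about half of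
    [S].  A captive link vertex [g] beside the non-captive edge [a b] would
    contribute [g], its [D] link neighbours, [a] and [b], which is too many;
    and if no link vertex is captive, the link is a matching, with at least
    [2 * D] vertices. *)
Lemma link_captive x : 5 <= D -> dispersed x ->
  (forall a, a \in link x -> captive x a).
Proof.
move=> D5 dx a /linkP[b xab]; apply/negPn/negP => na.
have [xS aS bS] := tri_supp xab.
have [xNa xNb aNb] := tri_neq xab.
have [xa1 abD linkS] := dispersed_pair D5 dx xab na.
have xba : tri x b a by rewrite triC23.
have nb : ~~ captive x b.
  have [|z abz] := @pick_codeg a b [set x]; first by rewrite cards1; lia.
  rewrite inE => zx; apply/captiveP => /(_ a z).
  by rewrite triC12 abz !inE (negPf xNa) eq_sym (negPf zx) => /(_ isT).
have [xb1 _ _] := dispersed_pair D5 dx xba nb.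
have [/existsP[g /andP[gx cg]] | none] :=
    boolP [exists g, (g \in link x) && captive x g]; last first.
  have : tdeg x <= #|link x|.
    rewrite /tdeg -sum1_card [X in _ <= X]big_mkcond; apply: leq_sum => g _.
    case: ifP => [gx|]; last by rewrite inE lt0n => /negbFE/eqP->.
    have ng : ~~ captive x g.
      by apply: contra none => cg; apply/existsP; exists g; rewrite gx.
    by have /linkP[h xgh] := gx; have [] := dispersed_pair D5 dx xgh ng.
  have := mindeg xS; lia.
have /linkP[h xgh] := gx; have [_ gS _] := tri_supp xgh.
have gNa : g != a by apply: contraNneq na => <-.
have gNb : g != b by apply: contraNneq nb => <-.
have sub : [set c | tri x g c] \subset link x :\: [set c in [:: g; a; b]].
  apply/subsetP => c; rewrite !inE => xgc.
  have [_ _ gNc] := tri_neq xgc.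
  rewrite (codeg_gt0 (_ : tri x c g)) ?[tri x c g]triC23 // andbT eq_sym !negb_or gNc /=.
  apply/andP; split; apply: contraTneq xgc => ->; rewrite triC23; apply/negP.
    by move/(codeg_le1 xa1 xab)/eqP; rewrite eq_sym (negPf gNb).
  by move/(codeg_le1 xb1 xba)/eqP; rewrite eq_sym (negPf gNa).
have : codeg x g <= #|link x :\: [set c in [:: g; a; b]]| := subset_leq_card sub.
rewrite cardsDS; last first.
  apply/subsetP => c; rewrite inE !in_cons in_nil orbF => /or3P[]/eqP-> //.
    by apply/linkP; exists b.
  by apply/linkP; exists a.
have -> : #|[set c in [:: g; a; b]]| = 3.
  by rewrite cardsE (card_uniqP _) //= !inE negb_or gNa gNb aNb.
by move: (captive_codeg gS cg) linkS D5; clear; lia.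
Qed.

(** The ends [a], [b] of a link edge have disjoint neighbourhoods in the link,
    since a common neighbour would form a triangle at the captive vertex [a]
    avoiding [x].  So the link has [2 * D] vertices, and at most one vertex is
    left for the triangles avoiding [x]. *)
Lemma dispersed_apex x : 5 <= D -> dispersed x -> apex x.
Proof.
move=> D5 dx p q r pqr; apply/negPn/negP => xpqr.
have capt := link_captive D5 dx.
have [a [b [xab _ _]]] := dispersedP dx (leq_trans (eq_leq (cards0 _)) (leq0n _)).
have [xS aS bS] := tri_supp xab.
have [xNa xNb aNb] := tri_neq xab.
have aL : a \in link x by apply/linkP; exists b.
have bL : b \in link x by apply/linkP; exists a; rewrite triC23.
have aD := captive_codeg aS (capt _ aL).
have bD := captive_codeg bS (capt _ bL).
have lD : 2 * D <= #|link x|.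
  rewrite mul2n -addnn; apply: leq_trans (leq_add aD bD) _.
  rewrite -cardsUI [_ :&: _](_ : _ = set0).
    rewrite cards0 addn0; apply/subset_leq_card/subsetP => z.
    by rewrite !in_setU !inE => /orP[]; rewrite triC23; apply: codeg_gt0.
  apply/setP => c; rewrite !inE; apply/negP => /andP[xac xbc].
  have /captiveP/(_ b c) := capt _ aL; rewrite !inE (negPf xNb) /=.
  have [_ /negPf-> _] := tri_neq xac; rewrite /tri.
  by case/and3P: xab => _ _ ->; case/and3P: xac => _ _ ->; case/and3P: xbc => _ _ -> /(_ isT).
have out y u v : tri y u v -> x \notin [:: y; u; v] -> y \in S :\: (x |: link x).
  move=> yuv; rewrite in_cons negb_or => /andP[xNy xuv].
  have [yS _ _] := tri_supp yuv.
  rewrite !in_setD !in_setU in_set1 yS andbT negb_or eq_sym xNy.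
  by apply: contraNN xuv => /capt/captiveP/(_ _ _ yuv).
have pO := out _ _ _ pqr xpqr.
have qO : q \in S :\: (x |: link x).
  apply: (out _ p r); first by rewrite triC12.
  by move: xpqr; rewrite !inE orbCA.
have [pNq _ _] := tri_neq pqr.
have : #|[set p; q]| <= #|S :\: (x |: link x)|.
  by apply/subset_leq_card/subsetP => z; rewrite in_set2 => /orP[]/eqP->.
rewrite cards2 pNq cardsDS; last first.
  apply/subsetP => z; rewrite in_setU1 => /orP[/eqP->//|/linkP[y /tri_supp[]//]].
rewrite cardsU1; have -> : x \notin link x.
  by apply/linkP => -[y /tri_neq[]]; rewrite eqxx.
by move: lD; rewrite /D; clear; lia.
Qed.

(** Some vertex of a cover by four vertices meets a quarter of the link
    edges. *)
Lemma heavy_edge x k : x \in S -> ~~ dispersed x -> 4 * k < D ->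
  exists y, k < codeg x y.
Proof.
move=> xS /not_dispersed[F F4 cov] kD.
apply/existsP; apply: contraTT kD => /existsPn none; rewrite -leqNgt.
have := leq_trans (mindeg xS) (tdeg_cover cov); rewrite leq_pmul2l // => le.
apply: leq_trans le _; apply: leq_trans (_ : \sum_(a in F) k <= _).
  by apply: leq_sum => a _; rewrite leqNgt none.
by rewrite sum_nat_const leq_mul2r F4 orbT.
Qed.

(** The hypothesis gives edges in more than 37 triangles; the argument has to
    avoid at most 18 vertices at a time. *)
Lemma exists_dispersed : 149 <= D -> exists2 x, x \in S & dispersed x.
Proof.
move=> D149; have [/existsP[x /andP[xS dx]]|none] :=
  boolP [exists x, (x \in S) && dispersed x]; first by exists x.
have nd x : x \in S -> ~~ dispersed x.
  by move=> xS; apply: contra none => dx; apply/existsP; exists x; rewrite xS.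
pose h x := odflt x [pick y | 37 < codeg x y].
have hP x : x \in S -> 37 < codeg x (h x).
  move=> xS; rewrite /h; case: pickP => //= H.
  have [|y] := @heavy_edge x 37 xS (nd _ xS); first by move: D149; clear; lia.
  by rewrite H.
pose fib x := [set z in S | h z == x].
(* Five vertices z with h z = x would make x dispersed: a set of at most four
   vertices misses one of them, and then a common neighbour of it and x. *)
have fib4 x : x \in S -> #|fib x| <= 4.
  move=> xS; rewrite leqNgt; apply: contra (nd x xS) => lt; apply: dispersedI => F F4.
  have [z] := pick_outside (leq_ltn_trans F4 lt).
  rewrite inE => /andP[zS /eqP hz] zF.
  have [|b zxb bF] := @pick_codeg z x F; first by have := hP z zS; rewrite hz; move: F4; clear; lia.
  by exists z, b; rewrite triC12.
have notfib x z : z \in S -> z \notin fib x -> h z != x by move=> zS; rewrite inE zS.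
have hS x : x \in S -> h x \in S.
  move=> /hP lt; have : 0 < codeg x (h x) by apply: leq_trans lt.
  by case/card_gt0P => z; rewrite inE => /tri_supp[].
have hcapt x : x \in S -> captive (h x) x.
  move=> xS; apply/captiveP => c d xcd; apply/negPn/negP => ycd.
  have [_ cS dS] := tri_supp xcd.
  (* The chain will be z w s, z x y, x c d with w = h z. *)
  set y := h x in ycd; have yS : y \in S := hS x xS.
  have [|z xyz] := @pick_codeg x y
    ([set c; d] :|: fib x :|: fib y :|: fib c :|: fib d).
    apply: leq_ltn_trans (hP x xS).
    rewrite !cardsU !cards1.
    by move: (fib4 _ xS) (fib4 _ yS) (fib4 _ cS) (fib4 _ dS); clear; lia.
  have [_ _ zS] := tri_supp xyz.
  rewrite !in_setU !negb_or -!andbA => /and5P[].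
  rewrite !in_set1 => zc zd /(notfib _ _ zS) wx /(notfib _ _ zS) wy.
  case/andP => /(notfib _ _ zS) wc /(notfib _ _ zS) wd.
  set w := h z in wx wy wc wd.
  have [|s zws sF] := @pick_codeg z w [set u in [:: x; y; c; d]].
    by apply: leq_ltn_trans (card_seq_le _) (leq_trans _ (hP z zS)).
  have zxy : tri z x y by rewrite triC12 triC23.
  have := free zws zxy xcd; rewrite /= !inE.
  move: (tri_uniq zws) (tri_uniq zxy) (tri_uniq xcd) sF ycd wx wy wc wd zc zd.
  rewrite /= !inE !(eq_sym s) !(eq_sym w) ?(eq_sym w s).
  by do ! case: eqP => //= _.
have /card_gt0P[x xS] : 0 < #|S| by move: D149; rewrite /D; clear; lia.
have [|z xyz] := @pick_codeg x (h x) (fib x :|: fib (h x)).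
  apply: leq_ltn_trans (hP x xS); rewrite cardsU; apply: leq_trans (leq_subr _ _) _.
  by move: (fib4 _ xS) (fib4 _ (hS _ xS)); clear; lia.
have [_ _ zS] := tri_supp xyz.
rewrite in_setU negb_or => /andP[/(notfib _ _ zS) wx /(notfib _ _ zS) wy].
have /captiveP/(_ x (h x)) := hcapt z zS; rewrite !inE (negPf wx) (negPf wy).
by rewrite triC12 triC23 => /(_ xyz).
Qed.

Lemma exists_apex : 149 <= D -> exists2 x, x \in S & apex x.
Proof.
move=> D149; have [x xS dx] := exists_dispersed D149; exists x => //.
by apply: dispersed_apex => //; apply: leq_trans D149.
Qed.

End Triangles.

(** * Mantel's theorem with its equality case *)

Section Mantel.

Variables (V : finType) (r : rel V) (M : {set V}).
Hypothesis rsym : symmetric r.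
Hypothesis rsupp : forall a b, r a b -> a \in M.
Hypothesis rfree : forall a b c, r a b -> r b c -> ~~ r a c.

(** [A] is the neighbourhood of a vertex of maximum degree.  It is independent,
    so every edge has an end in [M :\: A], where all degrees are at most
    [#|A|]; equality forces every vertex there to see all of [A]. *)
Lemma mantel : exists A : {set V},
  [/\ A \subset M,
      \sum_a \sum_b r a b <= 2 * (#|A| * (#|M| - #|A|)) &
      \sum_a \sum_b r a b = 2 * (#|A| * (#|M| - #|A|)) ->
      forall a b, a \in A -> b \in M :\: A -> r a b].
Proof.
have [V0|/card_gt0P[p0 _]] := posnP #|V|.
  have none (a : V) : False by have := card0_eq V0 a; rewrite inE.
  by exists set0; split=> [||_ a]; rewrite ?sub0set // big1 // => a; case: (none a).
pose deg a := #|[set b | r a b]|.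
have degE a : deg a = \sum_b r a b.
  by rewrite /deg -sum1_card big_mkcond; apply: eq_bigr => b _; rewrite inE; case: r.
have [p _ pmax] := @arg_maxnP V p0 predT deg isT.
pose A := [set b | r p b]; pose degA b := \sum_(a in A) r b a.
have AM : A \subset M by apply/subsetP => b; rewrite inE rsym; apply: rsupp.
have degAle b : degA b <= #|A|.
  by rewrite -sum1_card; apply: leq_sum => a _; case: r.
have sumE : \sum_a \sum_b r a b = \sum_(b in M :\: A) (degA b + deg b).
  rewrite big_split /= (bigID (mem A)) /=; congr (_ + _).
    rewrite [RHS]exchange_big; apply: eq_bigr => a aA.
    rewrite [RHS]big_mkcond /=; apply: eq_bigr => b _.
    case: ifP => [_|]; first by rewrite rsym.
    rewrite in_setD => /negP nb; case ab: (r a b) => //; case: nb.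
    have bM : b \in M by move: ab; rewrite rsym; apply: rsupp.
    rewrite bM andbT; apply: contraTN ab; rewrite !inE in aA * => pb.
    by apply: rfree pb; rewrite rsym.
  rewrite [RHS]big_mkcond [LHS]big_mkcond /=; apply: eq_bigr => a _.
  rewrite in_setD; case: (a \in A) => //=; case: ifP => aM.
    by rewrite degE.
  by rewrite big1 // => b _; case ab: (r a b) => //; rewrite (rsupp ab) in aM.
have cardE : \sum_(b in M :\: A) 2 * #|A| = 2 * (#|A| * (#|M| - #|A|)).
  by rewrite sum_nat_const cardsDS // mulnC mulnA.
have le b : b \in M :\: A ->
    degA b + deg b <= 2 * #|A| ?= iff (degA b + deg b == 2 * #|A|).
  by move=> _; apply: leqif_eq; rewrite mul2n -addnn; apply: leq_add (pmax b isT).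
have [le_sum eq_sum] := leqif_sum le; rewrite -sumE cardE in le_sum eq_sum.
exists A; split=> // /eqP; rewrite eq_sum => /forall_inP eqb a b aA bMA.
have /eqP := eqb b bMA; have : deg b <= deg p := pmax b isT.
have := degAle b; rewrite rsym; case rba: (r b a) => //.
have : degA b < #|A|.
  rewrite /degA -sum1_card (bigD1 a) //= [X in _ < X](bigD1 a) //= rba add0n add1n ltnS.
  by apply: leq_sum => c _; case: r.
have -> : deg p = #|A| by [].
by clear; lia.
Qed.

End Mantel.

(** * Counting triangles *)

Section Counting.

Variables (V : finType) (e : rel V).
Hypothesis esym : symmetric e.
Hypothesis eirr : irreflexive e.

Lemma tcountE : tcount e = \sum_a \sum_b \sum_c tri e a b c.
Proof. by apply: eq_bigr => a _; apply: eq_bigr => b _; rewrite codeg_sum. Qed.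

Lemma tdegE x : tdeg e x = \sum_a \sum_b tri e x a b.
Proof. by apply: eq_bigr => b _; rewrite codeg_sum. Qed.

(** By the symmetry of triangles each of the three positions contributes
    [tdeg e x].  As an upper bound on the triangles at [x] this controls
    deletions, and for an apex it counts all triangles. *)
Lemma tdeg_positions x :
  \sum_a \sum_b \sum_c
    ((a == x) && tri e a b c + (b == x) && tri e a b c + (c == x) && tri e a b c) =
  3 * tdeg e x.
Proof.
have first_pos : \sum_a \sum_b \sum_c ((a == x) && tri e a b c) = tdeg e x.
  rewrite (bigD1 x) //= [X in _ + X]big1 ?addn0 => [|a /negPf ax].
    by rewrite tdegE; do 2! (apply: eq_bigr => ? _); rewrite eqxx.
  by rewrite big1 // => b _; rewrite big1 // => c _; rewrite ax.
have second_pos : \sum_a \sum_b \sum_c ((b == x) && tri e a b c) = tdeg e x.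
  rewrite exchange_big -first_pos; do 3! (apply: eq_bigr => ? _).
  by rewrite triC12.
have third_pos : \sum_a \sum_b \sum_c ((c == x) && tri e a b c) = tdeg e x.
  rewrite -second_pos; apply: eq_bigr => a _; rewrite exchange_big.
  by do 2! (apply: eq_bigr => ? _); rewrite triC23.
rewrite !mulSn mul0n addn0 -{1}first_pos -{1}second_pos -third_pos addnA.
do 3! (rewrite -!big_split /=; apply: eq_bigr => ? _).
by [].
Qed.

Lemma apex_tcount x : apex e x -> tcount e = 3 * tdeg e x.
Proof.
move=> ax; rewrite tcountE -tdeg_positions.
do 3! (apply: eq_bigr => ? _); case T: tri; rewrite ?andbF //.
have := ax _ _ _ T; have [ab ac bc] := tri_neq eirr T.
rewrite !andbT !inE ![x == _]eq_sym; do ! case: eqP => //= ?; subst; try by rewrite eqxx in ab.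
- by rewrite eqxx in ac.
- by rewrite eqxx in bc.
Qed.

(** The link of an apex is triangle-free, so Mantel's theorem applies to it on
    the remaining vertices. *)
Lemma apex_link_bound (S : {set V}) x : (forall a b, e a b -> a \in S) ->
  x \in S -> apex e x ->
  exists A : {set V},
  [/\ A \subset S :\ x,
      tcount e <= 6 * (#|A| * (#|S| - 1 - #|A|)) &
      tcount e = 6 * (#|A| * (#|S| - 1 - #|A|)) ->
      forall a b, a \in A -> b \in (S :\ x) :\: A -> tri e x a b].
Proof.
move=> eS xS ax.
have [|||A [AS le eq]] := @mantel V (fun a b => tri e x a b) (S :\ x).
- by move=> a b; rewrite triC23.
- move=> a b xab; have [xa _ _] := tri_neq eirr xab.
  have [_ aS _] := tri_supp esym eS xab.
  by rewrite in_setD1 eq_sym xa.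
- move=> a b c xab xbc; apply/negP => xac.
  have abc : tri e a b c.
    rewrite /tri; case/and3P: xab => _ _ ->; case/and3P: xac => _ _ ->.
    by case/and3P: xbc.
  have [/negPf xa /negPf xb _] := tri_neq eirr xab.
  have [_ /negPf xc _] := tri_neq eirr xac.
  by have := ax _ _ _ abc; rewrite !inE xa xb xc.
have cS : #|S :\ x| = #|S| - 1 by rewrite (cardsD1 x S) xS add1n subn1.
exists A; rewrite -cS (apex_tcount ax) tdegE; split=> //.
  by move: le; clear; lia.
by move=> E; apply: eq; move: E; clear; lia.
Qed.

Definition within (S : {set V}) : rel V :=
  fun x y => [&& x \in S, y \in S & e x y].

Lemma within_sym S : symmetric (within S).
Proof. by move=> x y; rewrite /within andbCA esym. Qed.

Lemma within_irr S : irreflexive (within S).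
Proof. by move=> x; rewrite /within eirr !andbF. Qed.

Lemma within_supp S x y : within S x y -> x \in S.
Proof. by case/and3P. Qed.

Lemma tri_within S x y z :
  tri (within S) x y z = [&& x \in S, y \in S, z \in S & tri e x y z].
Proof.
rewrite /tri /within; case: (x \in S); case: (y \in S); case: (z \in S) => //=.
by rewrite andbF.
Qed.

Lemma within_free S : loose_free e -> loose_free (within S).
Proof.
move=> free p q c a b d f; rewrite !tri_within.
by move=> /and4P[_ _ _ T1] /and4P[_ _ _ T2] /and4P[_ _ _ T3]; apply: free T1 T2 T3.
Qed.

Lemma within_setT : within setT =2 e.
Proof. by move=> x y; rewrite /within !inE. Qed.

End Counting.

Lemma eq_tri (V : finType) (e e' : rel V) : e =2 e' ->
  forall x y z, tri e x y z = tri e' x y z.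
Proof. by move=> E x y z; rewrite /tri !E. Qed.

Lemma eq_tcount (V : finType) (e e' : rel V) : e =2 e' -> tcount e = tcount e'.
Proof.
by move=> /eq_tri E; rewrite !tcountE; do 3! (apply: eq_bigr => ? _); rewrite E.
Qed.

(** * The structure of dense chain-free graphs *)

Section Extremal.

Variables (V : finType) (e : rel V).
Hypothesis esym : symmetric e.
Hypothesis eirr : irreflexive e.

Lemma tcount_delete (S : {set V}) x :
  tcount (within e S) <= tcount (within e (S :\ x)) + 3 * tdeg (within e S) x.
Proof.
rewrite -(tdeg_positions (within_sym esym S)) !tcountE -big_split.
apply: leq_sum => a _; rewrite -big_split; apply: leq_sum => b _.
rewrite -big_split; apply: leq_sum => c _ /=; rewrite !tri_within !in_setD1.
by case: (a == x); case: (b == x); case: (c == x) => /=;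
  case: (a \in S); case: (b \in S); case: (c \in S) => //=; case: tri.
Qed.

Lemma tcount_within_le (S : {set V}) : tcount (within e S) <= #|S| ^ 3.
Proof.
rewrite tcountE.
have -> : #|S| ^ 3 = \sum_a \sum_b \sum_c [&& a \in S, b \in S & c \in S].
  have E (F : nat) : \sum_a (a \in S) * F = #|S| * F.
    rewrite -sum1_card [in RHS]big_mkcond big_distrl.
    by apply: eq_bigr => a _; case: ifP.
  rewrite !expnS expn0 -!E; apply: eq_bigr => a _.
  rewrite big_distrr; apply: eq_bigr => b _ /=.
  rewrite !big_distrr; apply: eq_bigr => c _ /=.
  by case: (a \in S); case: (b \in S); case: (c \in S).
apply: leq_sum => a _; apply: leq_sum => b _; apply: leq_sum => c _.
rewrite tri_within.
by case: (a \in S); case: (b \in S); case: (c \in S) => //=; case: tri.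
Qed.

Let turan k := (k - 1) ^ 2 %/ 4.

Lemma turan_step k : 0 < k -> turan k = turan k.-1 + (k - 1)./2.
Proof.
case: k => // -[//|k] _; rewrite /turan /= !subn1 /= -(odd_double_half k).
case: (odd k) => /=; rewrite -!mul2n; move: (k./2) => j.
  rewrite (_ : (1 + 2 * j).+1 ^ 2 = (j.+1 ^ 2) * 4); last by lia.
  rewrite (_ : (1 + 2 * j) ^ 2 = (j ^ 2 + j) * 4 + 1); last by lia.
  by rewrite mulnK // divnMDl //; lia.
rewrite (_ : (0 + 2 * j).+1 ^ 2 = (j ^ 2 + j) * 4 + 1); last by lia.
rewrite (_ : (0 + 2 * j) ^ 2 = (j ^ 2) * 4); last by lia.
by rewrite mulnK // divnMDl //; lia.
Qed.

(** The surplus [n - #|S|] records the number of deleted vertices: a deletion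
    loses at most [6 * D - 3] ordered triangles while six times the extremal
    function drops by [6 * D]. *)
Lemma peel n (S : {set V}) : #|S| <= n ->
  6 * turan #|S| + (n - #|S|) <= tcount (within e S) ->
  exists S' : {set V},
  [/\ #|S'| <= n, 6 * turan #|S'| + (n - #|S'|) <= tcount (within e S') &
      forall x, x \in S' -> 2 * (#|S'| - 1)./2 <= tdeg (within e S') x].
Proof.
have [k] := ubnP #|S|; elim: k S => // k IH S Sk Sn lb.
have [/forall_inP ?|/forall_inPn[x xS]] :=
  boolP [forall x in S, 2 * (#|S| - 1)./2 <= tdeg (within e S) x]; first by exists S.
rewrite -ltnNge => low; have cS := cardsD1 x S; rewrite xS add1n in cS.
apply: (IH (S :\ x)); [by move: Sk; rewrite cS | by apply: ltnW; rewrite -cS |].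
have := tcount_delete S x; have := turan_step (_ : 0 < #|S|).
rewrite {1 3 4}cS /= => /(_ isT) st del.
by move: cS st del low lb Sn; clear; lia.
Qed.

Hypothesis free : loose_free e.

(** With at most 299 vertices left, the cubic bound on ordered triangles could
    not accommodate a surplus of [300 ^ 3 - 299]. *)
Lemma extremal_structure : 300 ^ 3 <= #|V| -> 6 * turan #|V| <= tcount e ->
  exists x (A : {set V}), [/\ apex e x, x \notin A,
    #|A| * (#|V| - 1 - #|A|) = turan #|V| &
    forall a b, a \in A -> b != x -> b \notin A -> tri e x a b].
Proof.
move=> V300 lb; have [||S [Sn lbS low]] := @peel #|V| setT.
- by rewrite cardsT.
- by rewrite cardsT subnn addn0 (eq_tcount (within_setT e)).
have S300 : 300 <= #|S|.
  have le := leq_trans lbS (tcount_within_le S); rewrite leqNgt.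
  apply/negP => lt; have : #|S| ^ 3 <= 299 ^ 3 by rewrite leq_exp2r.
  by move: V300 Sn le lt; clear; lia.
have [|x xS ax] := exists_apex (within_sym esym S) (within_irr eirr S)
  (within_free free) (@within_supp _ e S) low.
  by move: S300; clear; lia.
have [A [AS le eq]] := apex_link_bound (within_sym esym S) (within_irr eirr S)
  (@within_supp _ e S) xS ax.
(* Mantel's bound on S leaves no surplus, so S is everything. *)
have small : #|A| * (#|S| - 1 - #|A|) <= turan #|S|.
  rewrite /turan leq_divRL //.
  move: (#|S| - 1) (#|A|) => m a; have [le_am|/ltnW] := leqP a m; last first.
    by rewrite -subn_eq0 => /eqP->; rewrite muln0.
  rewrite -{2}(subnKC le_am); move: (m - a) => b; clear.
  by have := (nat_Cauchy a b).1; rewrite sqrnD; lia.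
have SV : #|S| = #|V| by move: le small lbS Sn; clear; lia.
have ST : S = setT by apply/eqP; rewrite eqEcard subsetT cardsT SV /=.
have wE := eq_tri (within_setT e); rewrite -ST in wE.
exists x, A; split.
- by move=> a b c; rewrite -wE; apply: ax.
- by apply/negP => /(subsetP AS); rewrite !inE eqxx.
- by rewrite -SV; move: le small lbS; clear; lia.
move=> a b aA bx bA; rewrite -wE; apply: eq => //; last by rewrite ST !inE bx bA.
by move: le small lbS; clear; lia.
Qed.

End Extremal.

(** * Copies as injective homomorphisms *)

Section Adjacency.

Variables (V : finType) (G : graph V).

Lemma adjC : symmetric (adj G).
Proof. by move=> x y; rewrite /adj /= setUC. Qed.

Lemma edge_card2 e : e \in edges G -> #|e| = 2.
Proof. by move/(subsetP (edgesP G)); rewrite inE => /eqP. Qed.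

Lemma adj_irr : irreflexive (adj G).
Proof. by move=> x; apply/negP => /edge_card2; rewrite setUid cards1. Qed.

End Adjacency.

Section Copies.

Variables (W V : finType) (H : graph W) (G : graph V).

(** In a copy every edge joins two vertices of the image, so the edge set is
    exactly the image of the edges of [H]. *)
Lemma copiesP (S : {set V} * {set {set V}}) :
  reflect (exists f : W -> V, [/\ injective f,
      forall x y, adj H x y -> adj G (f x) (f y),
      S.1 = f @: setT & S.2 = [set f @: (e : {set W}) | e in edges H]])
    (S \in copies H G).
Proof.
have pairE (f : W -> V) x y : f @: [set x; y] = [set f x; f y].
  by rewrite imsetU1 imset_set1.
apply: (iffP idP) => [|[f [injf homf S1 S2]]].
  rewrite inE => /andP[/andP[/subsetP sub /forall_inP inside]].
  case/existsP => f /and3P[/injectiveP injf /eqP S1 /forallP iso].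
  have isoE x y : adj H x y = ([set f x; f y] \in S.2).
    by have /forallP/(_ y)/eqP := iso x.
  exists f; split=> // [x y|]; first by rewrite isoE => /sub.
  apply/setP => e; apply/idP/imsetP => [eS|[d dH ->]].
    have /eqP/cards2P[u [v [_ eE]]] := edge_card2 (sub _ eS).
    have := inside _ eS; rewrite eE subUset !sub1set -S1.
    case/andP => /imsetP[x _ uE] /imsetP[y _ vE]; exists [set x; y]; last by rewrite pairE uE vE.
    by have : adj H x y by rewrite isoE -uE -vE -eE.
  have /eqP/cards2P[u [v [_ dE]]] := edge_card2 dH.
  by rewrite dE pairE -isoE /adj /= -dE.
rewrite inE; apply/andP; split.
  apply/andP; split.
    apply/subsetP => e; rewrite S2 => /imsetP[d dH ->].
    have /eqP/cards2P[u [v [_ dE]]] := edge_card2 dH.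
    by rewrite dE pairE; apply: homf; rewrite /adj /= -dE.
  by apply/forall_inP => e; rewrite S2 S1 => /imsetP[d _ ->]; apply/imsetS/subsetT.
apply/existsP; exists (finfun f); apply/and3P; split.
- by apply/injectiveP => x y; rewrite !ffunE; apply: injf.
- by rewrite S1; apply/eqP/eq_imset => x; rewrite ffunE.
apply/forallP => x; apply/forallP => y; rewrite !ffunE S2 -pairE.
by rewrite mem_imset //; apply: imset_inj.
Qed.

Lemma HfreeP : reflect
  (forall f : W -> V, injective f -> ~ forall x y, adj H x y -> adj G (f x) (f y))
  (Hfree H G).
Proof.
apply: (iffP eqP) => [none f injf homf | none].
  have : (f @: setT, [set f @: (e : {set W}) | e in edges H]) \in copies H G.
    by apply/copiesP; exists f.
  by rewrite none inE.
by apply/setP => S; rewrite in_set0; apply/copiesP => -[f [injf homf _ _]]; apply: (none f).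
Qed.

End Copies.

(** * Copies of the triangle *)

Section TriangleCopies.

Variables (V : finType) (G : graph V).

Lemma adj_complete n (i j : 'I_n) : adj (complete n) i j = (i != j).
Proof. by rewrite adj_graph_of andbT. Qed.

(** The edge set of a clique consists of all pairs in its vertex set. *)
Lemma copies_complete_inj n :
  {in copies (complete n) G &, injective (fun S : {set V} * {set {set V}} => S.1)}.
Proof.
have spec S : S \in copies (complete n) G ->
    S.2 = [set e : {set V} | (#|e| == 2) && (e \subset S.1)].
  case/copiesP => f [injf homf S1 S2]; apply/setP => e; rewrite S2 S1 inE.
  apply/imsetP/andP => [[d dK ->]|[/cards2P[u [v [uv eE]]] eS]].
    by rewrite card_imset ?(edge_card2 dK) // imsetS ?subsetT.
  move: eS; rewrite eE subUset !sub1set => /andP[/imsetP[i _ ui] /imsetP[j _ vj]].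
  exists [set i; j]; last by rewrite imsetU1 imset_set1 ui vj.
  suff: adj (complete n) i j by [].
  by rewrite adj_complete; apply: contra uv => /eqP ij; rewrite ui vj ij.
by move=> [A E] [A' E'] /spec /= -> /spec /= -> ->.
Qed.

Lemma copies_triangleP (S : {set V} * {set {set V}}) :
  S \in copies (complete 3) G ->
  exists x y z, tri (adj G) x y z /\ S.1 = [set x; y; z].
Proof.
case/copiesP => f [injf homf S1 _].
exists (f ord0), (f (lift ord0 ord0)), (f ord_max); split.
  by apply/and3P; split; apply: homf; rewrite adj_complete.
rewrite S1; apply/setP => u; apply/imsetP/idP => [[i _ ->]|].
  by case: i => -[|[|[|//]]] i3; rewrite !inE -orbA; apply/or3P;
    [apply: Or31 | apply: Or32 | apply: Or33];
    apply/eqP; congr f; apply: val_inj.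
by rewrite !inE -orbA => /or3P[]/eqP->; eexists.
Qed.

Lemma triangle_copy x y z : tri (adj G) x y z ->
  exists2 S, S \in copies (complete 3) G & S.1 = [set x; y; z].
Proof.
move=> xyz; pose f (i : 'I_3) := nth x [:: x; y; z] i.
have injf : injective f.
  have xyzU : uniq [:: x; y; z] := tri_uniq (adj_irr G) xyz.
  by move=> i j /eqP; rewrite nth_uniq // => /eqP/val_inj.
exists (f @: setT, [set f @: (e : {set 'I_3}) | e in edges (complete 3)]).
  apply/copiesP; exists f; split=> // i j; rewrite adj_complete => ij.
  have fij : f i != f j by apply: contra ij => /eqP/injf->.
  case/and3P: xyz => xy xz yz; move: fij; rewrite /f.
  by case: i {ij} => -[|[|[|//]]] ? /=; case: j => -[|[|[|//]]] ? /=;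
    rewrite ?eqxx // adjC.
apply/setP => u; apply/imsetP/idP => [[i _ ->]|].
  by rewrite /f; case: i => -[|[|[|//]]] ? /=; rewrite !inE eqxx ?orbT.
rewrite !inE -orbA => /or3P[]/eqP->.
- by exists ord0.
- by exists (lift ord0 ord0).
- by exists ord_max.
Qed.

Lemma orderings_triangle x y z : tri (adj G) x y z ->
  \sum_a \sum_b \sum_c (tri (adj G) a b c && ([set x; y; z] == [set a; b; c])) = 6.
Proof.
move=> xyz; have := tri_uniq (adj_irr G) xyz.
rewrite /= !inE negb_or andbT -andbA => /and3P[xNy xNz yNz].
pose s := [:: (x, y, z); (x, z, y); (y, x, z); (y, z, x); (z, x, y); (z, y, x)].
have <- : #|s| = 6.
  rewrite (card_uniqP _) // /s /= !inE !xpair_eqE.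
  by rewrite !eqxx !(negPf xNy, negPf xNz, negPf yNz, eq_sym y x, eq_sym z x, eq_sym z y).
rewrite -sum1_card [RHS]big_mkcond pair_bigA pair_bigA.
apply: eq_bigr => -[[a b] c] _ /=.
have C12 := triC12 (@adjC _ G); have C23 := triC23 (@adjC _ G).
have sE : ((a, b, c) \in s) = tri (adj G) a b c && ([set x; y; z] == [set a; b; c]).
  apply/idP/andP => [|[abc /eqP/setP E]].
    have xzy : tri (adj G) x z y by rewrite -C23.
    have yxz : tri (adj G) y x z by rewrite -C12.
    have zxy : tri (adj G) z x y by rewrite -C12.
    have setE (P Q : {set V}) : (forall u, (u \in P) = (u \in Q)) -> P == Q.
      by move=> PQ; apply/eqP/setP.
    rewrite /s !in_cons in_nil orbF => /or4P[/eqP[-> -> ->]|/eqP[-> -> ->]|/eqP[-> -> ->]|].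
    - by split.
    - by split=> //; apply: setE => u; rewrite !inE orbAC.
    - by split=> //; apply: setE => u; rewrite !inE [(u == x) || _]orbC.
    case/or3P => /eqP[-> -> ->].
    - split; first by rewrite C23.
      by apply: setE => u; rewrite !inE -orbA orbC.
    - by split=> //; apply: setE => u; rewrite !inE orbC orbA.
    - split; first by rewrite C23.
      by apply: setE => u; rewrite !inE -orbA orbC [(u == y) || _]orbC.
  have [ab ac bc] := tri_neq (adj_irr G) abc.
  have aS : a \in [set x; y; z] by rewrite E !inE eqxx.
  have bS : b \in [set x; y; z] by rewrite E !inE eqxx orbT.
  have cS : c \in [set x; y; z] by rewrite E !inE eqxx orbT.
  move: aS bS cS ab ac bc; rewrite !inE -!orbA /s.
  by do 3! (case/or3P => /eqP->); rewrite ?eqxx ?orbT.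
by rewrite sE; case: (_ && _).
Qed.

Lemma card_copies_triangle : 6 * #|copies (complete 3) G| = tcount (adj G).
Proof.
rewrite tcountE mulnC -sum_nat_const.
have split_tri a b c : tri (adj G) a b c =
    \sum_(S in copies (complete 3) G) (tri (adj G) a b c && (S.1 == [set a; b; c])) :> nat.
  have [abc|_] := boolP (tri _ a b c); last by rewrite big1.
  have [S SK S1] := triangle_copy abc.
  rewrite (bigD1 S) //= S1 eqxx big1 // => S' /andP[S'K]; rewrite -S1 /=.
  by case: (S'.1 =P S.1) => // S1E /eqP[]; apply: (copies_complete_inj S'K SK S1E).
have -> : \sum_a \sum_b \sum_c tri (adj G) a b c =
    \sum_a \sum_b \sum_c \sum_(S in copies (complete 3) G)
       (tri (adj G) a b c && (S.1 == [set a; b; c])).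
  by do 3! (apply: eq_bigr => ? _); apply: split_tri.
under [RHS]eq_bigr => a _ do under eq_bigr => b _ do rewrite exchange_big.
under [RHS]eq_bigr => a _ do rewrite exchange_big.
rewrite [RHS]exchange_big; apply: eq_bigr => S /copies_triangleP[x [y [z [xyz ->]]]].
by rewrite orderings_triangle.
Qed.

(** The first and the last triangle of the blown-up path are disjoint, but both
    would contain the apex. *)
Lemma apex_Hfree x : apex (adj G) x -> Hfree (edge_blowup (path_graph 3) 3) G.
Proof.
move=> ax; apply/HfreeP => f injf homf.
have edge_tri (i j : 'I_4) (ij : j = i.+1 :> nat) :
    exists w, tri (adj G) (f (inl i)) (f (inl j)) (f (inr w)) /\
      val w.1 = [set i; j].
  have ijE : [set i; j] \in edges (path_graph 3).
    suff: adj (path_graph 3) i j by [].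
    rewrite adj_graph_of ij eqxx /= andbT; apply/eqP => E.
    by move: ij; rewrite E; clear; lia.
  pose ij_edge : edge_type (path_graph 3) :=
    exist (fun e => e \in edges (path_graph 3)) [set i; j] ijE.
  pose w : edge_type (path_graph 3) * 'I_(3 - 2) := (ij_edge, ord0 : 'I_1).
  have cl X Y : X \in blowup_clique 3 w.1 -> Y \in blowup_clique 3 w.1 -> X != Y ->
      adj (edge_blowup (path_graph 3) 3) X Y.
    move=> XC YC XY; rewrite /adj /= inE cards2 XY /=; apply/existsP; exists w.1.
    by rewrite subUset !sub1set XC YC.
  have inlC k : k \in [set i; j] -> inl k \in blowup_clique 3 w.1.
    by move=> kE; rewrite in_setU; apply/orP; left; apply: imset_f.
  have inrC : inr w \in blowup_clique 3 w.1.
    by rewrite in_setU; apply/orP; right; apply: imset_f.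
  exists w; split=> //; apply/and3P; split; apply: homf; apply: cl => //;
    try by apply: inlC; rewrite !inE eqxx ?orbT.
  by apply/eqP => -[E]; move: ij; rewrite E; clear; lia.
have [w [T wE]] := @edge_tri (inord 0) (inord 1) ltac:(by rewrite !inordK).
have [w' [T' w'E]] := @edge_tri (inord 2) (inord 3) ltac:(by rewrite !inordK).
have ww' : w == w' = false.
  apply/eqP => E; have : (inord 0 : 'I_4) \in [set inord 2; inord 3].
    by rewrite -w'E -E wE !inE eqxx.
  by rewrite !inE -!val_eqE /= !inordK.
have := ax _ _ _ T'; have := ax _ _ _ T; rewrite !inE.
have ordF a b : a < 4 -> b < 4 -> (inord a == inord b :> 'I_4) = (a == b).
  by move=> a4 b4; rewrite -val_eqE /= !inordK.
case/or3P => /eqP->; rewrite !(inj_eq injf) /eq_op /= ?ordF ?ww' //.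
Qed.

End TriangleCopies.

(** * The blow-up of the path as a chain of triangles *)

Section Embedding.

Variables (V : finType) (G : graph V).

Definition path_edges : seq {set 'I_4} :=
  [seq [set inord k; inord k.+1] | k <- iota 0 3].

Lemma mem_path_edges e : e \in edges (path_graph 3) -> e \in path_edges.
Proof.
move=> eP; have /eqP/cards2P[i [j [ij eE]]] := edge_card2 eP.
have : adj (path_graph 3) i j by rewrite /adj /= -eE.
rewrite adj_graph_of ij eE /=.
have mem (a b : 'I_4) : b == a.+1 :> nat -> [set a; b] \in path_edges.
  move=> /eqP ab; apply/mapP; exists (a : nat).
    by rewrite mem_iota; have := ltn_ord b; rewrite ab.
  by rewrite -ab !inord_val.
by case/orP => /mem //; rewrite setUC.
Qed.

Definition edge_rank (e : edge_type (path_graph 3)) := index (val e) path_edges.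

(** Numbers the seven vertices such that the [k]-th clique has ranks [k],
    [k.+1] and [4 + k]; a chain is then embedded by a list of its vertices. *)
Definition vertex_rank (X : blowup_type (path_graph 3) 3) : nat :=
  match X with inl i => i | inr w => 4 + edge_rank w.1 end.

Lemma edge_rank_lt e : edge_rank e < 3.
Proof. by have := mem_path_edges (valP e); rewrite -index_mem. Qed.

Lemma edge_rankE e : val e = [set inord (edge_rank e); inord (edge_rank e).+1].
Proof.
have := nth_index set0 (mem_path_edges (valP e)); rewrite -/(edge_rank e) => {1}<-.
by rewrite (nth_map 0) ?size_iota ?edge_rank_lt // nth_iota ?edge_rank_lt.
Qed.

Lemma vertex_rank_inj : injective vertex_rank.
Proof.
move=> [i|[e k]] [j|[e' k']] /=.
- by move/val_inj->.
- by move=> E; have := ltn_ord i; rewrite E; clear; lia.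
- by move=> E; have := ltn_ord j; rewrite -E; clear; lia.
move/addnI => E; have -> : e = e' by apply: val_inj; rewrite !edge_rankE E.
by congr (inr (_, _)); apply: val_inj; move: k k' => [[|//] ?] [[|//] ?].
Qed.

Lemma vertex_rank_lt X : vertex_rank X < 7.
Proof.
case: X => [i|[e k]] /=; first by apply: leq_trans (ltn_ord i) _.
by have := edge_rank_lt e; clear; lia.
Qed.

Lemma vertex_rank_clique e X : X \in blowup_clique 3 e ->
  vertex_rank X \in [:: edge_rank e; (edge_rank e).+1; 4 + edge_rank e].
Proof.
rewrite in_setU => /orP[/imsetP[i]|/imsetP[k _ ->]]; last by rewrite !inE eqxx !orbT.
have lt := edge_rank_lt e.
rewrite edge_rankE !inE => /orP[]/eqP-> -> /=; rewrite inordK ?eqxx ?orbT //.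
by apply: leq_trans lt _.
Qed.

Lemma Hfree_loose_free :
  Hfree (edge_blowup (path_graph 3) 3) G -> loose_free (adj G).
Proof.
move=> /HfreeP none p q c a b d f T1 T2 T3; apply/negP => U.
pose s := [:: a; p; q; d; b; c; f].
have Us : uniq s.
  rewrite (@perm_uniq _ s [:: p; q; c; a; b; d; f]) //.
  by apply/permP => P /=; clear; lia.
pose F X := nth a s (vertex_rank X).
have nthE i j : i < 7 -> j < 7 -> (nth a s i == nth a s j) = (i == j).
  by move=> i7 j7; rewrite nth_uniq.
have injF : injective F.
  move=> X Y /eqP; rewrite nthE ?vertex_rank_lt // => /eqP; apply: vertex_rank_inj.
apply: (none F injF) => X Y XY.
have XNY : X != Y by apply/eqP => E; move: XY; rewrite E adj_irr.
have /existsP[e] : [exists e : edge_type (path_graph 3), [set X; Y] \subset blowup_clique 3 e].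
  by move: XY; rewrite /adj /= inE => /andP[].
rewrite subUset !sub1set => /andP[/vertex_rank_clique Xe /vertex_rank_clique Ye].
have : vertex_rank X != vertex_rank Y by apply: contra XNY => /eqP/vertex_rank_inj->.
have clique k x y : tri (adj G) (nth a s k) (nth a s k.+1) (nth a s (4 + k)) ->
    x \in [:: k; k.+1; 4 + k] -> y \in [:: k; k.+1; 4 + k] -> x != y ->
    adj G (nth a s x) (nth a s y).
  case/and3P => t1 t2 t3; rewrite !inE => /or3P[]/eqP-> /or3P[]/eqP->;
    by rewrite ?eqxx // adjC.
apply: clique Xe Ye; case: (edge_rank e) (edge_rank_lt e) => [|[|[|//]]] _ //=.
by rewrite (triC12 (@adjC _ G)).
Qed.

End Embedding.

(** * The extremal graph *)

Notation cone s t := (join (complete 1) (complete_bipartite s t)).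

Section Cone.

Variables (s t : nat).

Let K := cone s t.

Lemma adj_cone (X Y : 'I_1 + ('I_s + 'I_t)) : adj K X Y =
  match X, Y with
  | inl _, inr _ | inr _, inl _ => true
  | inr (inl _), inr (inr _) | inr (inr _), inr (inl _) => true
  | _, _ => false
  end.
Proof.
rewrite adj_graph_of.
case: X Y => [i|[i|i]] [j|[j|j]] //=; rewrite ?adj_graph_of ?andbF //=.
by rewrite (ord1 i) (ord1 j) eqxx.
Qed.

Lemma cone_apex : apex (adj K) (inl ord0).
Proof.
move=> a b c; rewrite /tri !adj_cone !inE.
case: a => [i|[i|i]]; first by rewrite (ord1 i) eqxx.
- case: b => [j|[j|j]] //; first by rewrite (ord1 j) eqxx orbT.
  by case: c => [k|[k|k]] //; rewrite (ord1 k) eqxx !orbT.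
- case: b => [j|[j|j]] //; first by rewrite (ord1 j) eqxx orbT.
  by case: c => [k|[k|k]] //; rewrite (ord1 k) eqxx !orbT.
Qed.

Lemma tcount_cone : tcount (adj K) = 6 * (s * t).
Proof.
rewrite (apex_tcount (@adjC _ K) (@adj_irr _ K) cone_apex) tdegE.
rewrite big_sumType /= big_ord1 big1 ?add0n => [|Y _]; last by rewrite /tri adj_cone.
rewrite big_sumType /=.
have row1 (i : 'I_s) : \sum_Y tri (adj K) (inl ord0) (inr (inl i)) Y = t.
  rewrite !big_sumType /= big_ord1 big1 => [|j _]; last by rewrite /tri !adj_cone.
  under eq_bigr => j _ do rewrite /tri !adj_cone /=.
  by rewrite sum1_card card_ord /tri !adj_cone.
have row2 (i : 'I_t) : \sum_Y tri (adj K) (inl ord0) (inr (inr i)) Y = s.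
  rewrite !big_sumType /= big_ord1 [X in _ + (_ + X)]big1 => [|j _]; last by rewrite /tri !adj_cone.
  under eq_bigr => j _ do rewrite /tri !adj_cone /=.
  by rewrite sum1_card card_ord /tri !adj_cone addn0.
rewrite (eq_bigr _ (fun i _ => row1 i)) (eq_bigr _ (fun i _ => row2 i)).
by rewrite !sum_nat_const !card_ord; clear; lia.
Qed.

Lemma card_cone : #|{: 'I_1 + ('I_s + 'I_t)}| = (s + t).+1.
Proof. by rewrite !card_sum !card_ord. Qed.

Variables (V : finType) (G : graph V).

Lemma iso_cone_count : isomorphic G K ->
  Hfree (edge_blowup (path_graph 3) 3) G /\ #|copies (complete 3) G| = s * t.
Proof.
case=> f bf homf; have [g fK gK] := bf.
have triE a b c : tri (adj G) a b c = tri (adj K) (f a) (f b) (f c).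
  by rewrite /tri !homf.
split.
  apply: (@apex_Hfree _ _ (g (inl ord0))) => a b c; rewrite triE => /cone_apex.
  by rewrite !inE -!(can_eq fK) gK.
apply/eqP; rewrite -(eqn_pmul2l (isT : 0 < 6)) card_copies_triangle -tcount_cone !tcountE.
apply/eqP; rewrite [RHS](reindex f) /=; last exact: onW_bij.
apply: eq_bigr => a _; rewrite [RHS](reindex f) /=; last exact: onW_bij.
apply: eq_bigr => b _; rewrite [RHS](reindex f) /=; last exact: onW_bij.
by apply: eq_bigr => c _; rewrite triE.
Qed.

Lemma cone_copy_on_ord n : n = (s + t).+1 -> exists H : graph 'I_n, isomorphic H K.
Proof.
move=> nE; have cE : n = #|{: 'I_1 + ('I_s + 'I_t)}| by rewrite card_cone.
pose f (i : 'I_n) : 'I_1 + ('I_s + 'I_t) := enum_val (cast_ord cE i).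
exists (graph_of (fun i j => adj K (f i) (f j))); exists f.
  exists (fun X => cast_ord (esym cE) (enum_rank X)) => X; rewrite /f.
    by rewrite enum_valK cast_ordK.
  by rewrite cast_ordKV enum_rankK.
move=> i j; rewrite adj_graph_of [adj K (f j) _]adjC orbb.
by case: eqP => // ->; rewrite adj_irr.
Qed.

End Cone.

(** * Recognizing the extremal graph *)

Section Recognition.

Variables (V : finType) (G : graph V).

(** An edge inside [A] or inside [B] would form a triangle avoiding [x] with
    any vertex of the other part. *)
Lemma cone_iso x (A B : {set V}) :
  apex (adj G) x -> 0 < #|A| -> 0 < #|B| ->
  (forall y, (y != x) = (y \in A) (+) (y \in B)) ->
  (forall y, y \in A -> y \notin B) ->
  (forall a b, a \in A -> b \in B -> tri (adj G) x a b) ->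
  isomorphic G (cone #|A| #|B|).
Proof.
move=> ax A0 B0 part disj full.
pose h (X : 'I_1 + ('I_#|A| + 'I_#|B|)) : V :=
  match X with inl _ => x | inr (inl i) => enum_val i | inr (inr j) => enum_val j end.
have Ax y : y \in A -> y != x by move=> yA; rewrite part yA (negPf (disj _ yA)).
have Bx y : y \in B -> y != x.
  by move=> yB; rewrite part yB addbT; apply/negP => /disj; rewrite yB.
have injh : injective h.
  move=> [i|[i|i]] [j|[j|j]] /=; rewrite ?(ord1 i) ?(ord1 j) //.
  - by move=> E; have := Ax _ (enum_valP j); rewrite -E eqxx.
  - by move=> E; have := Bx _ (enum_valP j); rewrite -E eqxx.
  - by move=> E; have := Ax _ (enum_valP i); rewrite E eqxx.
  - by move/enum_val_inj->.
  - by move=> E; have := disj _ (enum_valP i); rewrite E enum_valP.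
  - by move=> E; have := Bx _ (enum_valP i); rewrite E eqxx.
  - by move=> E; have := disj _ (enum_valP j); rewrite -E enum_valP.
  - by move/enum_val_inj->.
have surj y : exists X, h X = y.
  have [->|yx] := eqVneq y x; first by exists (inl ord0).
  have := yx; rewrite part; have [yA _|_ /= yB] := boolP (y \in A).
    by exists (inr (inl (enum_rank_in yA y))); rewrite /= enum_rankK_in.
  by exists (inr (inr (enum_rank_in yB y))); rewrite /= enum_rankK_in.
have bijh : bijective h.
  apply: (inj_card_bij injh); rewrite -(card_codom injh).
  by apply/subset_leq_card/subsetP => y _; have [X <-] := surj y; apply: codom_f.
have [h1 hK h1K] := bijh.
have [a0 a0A] := card_gt0P A0; have [b0 b0B] := card_gt0P B0.
have noAA a a' : a \in A -> a' \in A -> adj G a a' = false.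
  move=> aA a'A; apply/negP => aa'.
  have /and3P[xa xb ab] := full a b0 aA b0B.
  have /and3P[xa' _ a'b] := full a' b0 a'A b0B.
  have : tri (adj G) a a' b0 by apply/and3P.
  move/ax; rewrite !inE ![x == _]eq_sym.
  by rewrite (negPf (Ax _ aA)) (negPf (Ax _ a'A)) (negPf (Bx _ b0B)).
have noBB b b' : b \in B -> b' \in B -> adj G b b' = false.
  move=> bB b'B; apply/negP => bb'.
  have /and3P[_ _ ab] := full a0 b a0A bB.
  have /and3P[_ _ ab'] := full a0 b' a0A b'B.
  have : tri (adj G) a0 b b' by apply/and3P.
  move/ax; rewrite !inE ![x == _]eq_sym.
  by rewrite (negPf (Ax _ a0A)) (negPf (Bx _ bB)) (negPf (Bx _ b'B)).
have xA a : a \in A -> adj G x a by move=> aA; have /and3P[] := full a b0 aA b0B.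
have xB b : b \in B -> adj G x b by move=> bB; have /and3P[] := full a0 b a0A bB.
have AB a b : a \in A -> b \in B -> adj G a b.
  by move=> aA bB; have /and3P[] := full a b aA bB.
exists h1; first by exists h.
move=> u v; rewrite -{1}(h1K u) -{1}(h1K v) adj_cone.
have iA (i : 'I_#|A|) : enum_val i \in A := enum_valP i.
have iB (i : 'I_#|B|) : enum_val i \in B := enum_valP i.
case: (h1 u) => [i|[i|i]]; case: (h1 v) => [j|[j|j]] /=.
- exact: adj_irr.
- exact: xA.
- exact: xB.
- by rewrite adjC xA.
- exact: noAA.
- exact: AB.
- by rewrite adjC xB.
- by rewrite adjC AB.
- exact: noBB.
Qed.

End Recognition.

(** With [b = a + d] the right side is [a * b + d ^ 2 %/ 4], so [d < 2]. *)
Lemma balanced_parts a b : a * b = (a + b) ^ 2 %/ 4 ->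
  (a == (a + b)./2) && (b == uphalf (a + b)) ||
  (b == (a + b)./2) && (a == uphalf (a + b)).
Proof.
wlog le_ab : a b / a <= b => [H E|].
  have [/H|/ltnW/H] := leqP a b; first exact.
  by rewrite [b + a]addnC mulnC orbC; apply.
move=> E; apply/orP; left; move: E; rewrite -(subnKC le_ab); move: (b - a) => d.
rewrite (_ : (a + (a + d)) ^ 2 = a * (a + d) * 4 + d ^ 2); last by lia.
rewrite divnMDl // => E; have d2 : d < 2.
  by rewrite ltnNge; apply/negP => d2; have := leq_div2r 4 (leq_mul d2 d2); lia.
by case: d d2 {E} => [|[|//]] _; apply/andP; split; apply/eqP; rewrite ?uphalfE; lia.
Qed.

Lemma half_mul_uphalf m : m./2 * uphalf m = m ^ 2 %/ 4.
Proof.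
rewrite uphalf_half -{4}(odd_double_half m) -mul2n; move: (m./2) (odd m) => k [] /=.
  rewrite (_ : (1 + 2 * k) ^ 2 = (k * (1 + k)) * 4 + 1); last by lia.
  by rewrite divnMDl // addn0.
by rewrite (_ : (0 + 2 * k) ^ 2 = (k * (0 + k)) * 4) ?mulnK //; lia.
Qed.

Lemma dense_cone (V : finType) (G : graph V) : 300 ^ 3 <= #|V| ->
  Hfree (edge_blowup (path_graph 3) 3) G ->
  (#|V| - 1) ^ 2 %/ 4 <= #|copies (complete 3) G| ->
  isomorphic G (cone (#|V| - 1)./2 (uphalf (#|V| - 1))).
Proof.
move=> V300 /Hfree_loose_free free lb.
have [|x [A [ax xA AE full]]] := extremal_structure (@adjC _ G) (@adj_irr _ G) free V300.
  by rewrite -card_copies_triangle leq_pmul2l.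
pose B := ~: (x |: A).
have cB : #|B| = #|V| - 1 - #|A|.
  by have := cardsC (x |: A); rewrite cardsU1 xA -/B => <-; clear; lia.
have AB : #|A| + #|B| = #|V| - 1.
  by have := cardsC (x |: A); rewrite cardsU1 xA -/B => <-; clear; lia.
have pos : 0 < (#|V| - 1) ^ 2 %/ 4.
  rewrite divn_gt0 //; apply: leq_trans (_ : 2 ^ 2 <= _) => //.
  by rewrite leq_exp2r //; move: V300; clear; lia.
rewrite -cB in AE; move: pos; rewrite -AE muln_gt0 => /andP[A0 B0].
have AinB y : y \in A -> y \notin B by move=> yA; rewrite !inE yA orbT.
have part y : (y != x) = (y \in A) (+) (y \in B).
  by rewrite !inE; case: eqP => [->|_]; rewrite ?(negPf xA) //; case: (_ \in A).
have fullAB a b : a \in A -> b \in B -> tri (adj G) x a b.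
  by move=> aA; rewrite !inE negb_or => /andP[bx bA]; apply: full.
rewrite -AB in AE *; case/orP: (balanced_parts AE) => /andP[/eqP<- /eqP<-].
  exact: cone_iso ax A0 B0 part AinB fullAB.
apply: cone_iso ax B0 A0 _ _ _.
- by move=> y; rewrite addbC.
- by move=> y; apply: contraL => /AinB.
- by move=> b a bB aA; rewrite (triC23 (@adjC _ G)); apply: fullAB.
Qed.

Theorem theorem3 (n : nat) (hn : 300 ^ 3 <= n) :
  ex_turan n (complete 3) (edge_blowup (path_graph 3) 3) = (n - 1) ^ 2 %/ 4 /\
  (forall (V : finType) (G : graph V), #|V| = n ->
    (Hfree (edge_blowup (path_graph 3) 3) G /\
     #|copies (complete 3) G| =
       ex_turan n (complete 3) (edge_blowup (path_graph 3) 3))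
    <->
    isomorphic G
      (join (complete 1) (complete_bipartite (n - 1)./2 (uphalf (n - 1))))).
Proof.
have n0 : 0 < n by apply: leq_trans hn; rewrite expn_gt0.
have exE : ex_turan n (complete 3) (edge_blowup (path_graph 3) 3) = (n - 1) ^ 2 %/ 4.
  apply/eqP; rewrite eqn_leq; apply/andP; split.
    apply/bigmax_leqP => G free; rewrite leqNgt; apply/negP => lt.
    have V300 : 300 ^ 3 <= #|'I_n| by rewrite card_ord; exact: hn.
    have lb : (#|'I_n| - 1) ^ 2 %/ 4 <= #|copies (complete 3) G|.
      by rewrite card_ord; exact: ltnW.
    have [_ E] := iso_cone_count (dense_cone V300 free lb).
    by move: lt; rewrite E half_mul_uphalf card_ord ltnn.
  have [|G iso] := @cone_copy_on_ord (n - 1)./2 (uphalf (n - 1)) n.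
    by rewrite addnC uphalf_half -addnA addnn odd_double_half; move: n0; clear; lia.
  have [free cnt] := iso_cone_count iso.
  rewrite -half_mul_uphalf -cnt; exact: leq_bigmax_cond.
split=> // V G Vn; rewrite exE; split=> [[free cnt]|/iso_cone_count[free ->]].
  rewrite -Vn; apply: dense_cone free _; first by rewrite Vn; exact: hn.
  by rewrite Vn cnt.
by rewrite half_mul_uphalf.
Qed.
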